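(* Let $f : \mathcal{C}_d \to \mathbb{R}^+ \cup \{\infty\}$ be a well-defined, continuous, monotone function that admits a Helly theorem and such that there is a floating body for $f$, with associated parameter $\delta(\cdot)$. Let $0 < \varepsilon < 1$, let $h = H(f,d,\varepsilon)$, and let $\mathcal{F}_1, \mathcal{F}_2, \ldots, \mathcal{F}_h$ be finite families of convex sets in $\mathbb{R}^d$, considered as color classes. Suppose that for every colorful choice $F_1 \in \mathcal{F}_1, \ldots, F_h \in \mathcal{F}_h$ we have $f(F_1 \cap \cdots \cap F_h) \ge 1$. Then there is a color class $\mathcal{F}_i$ for which $$f\left(\bigcap \mathcal{F}_i\right) \ge 1 - \delta(\varepsilon).$$
   Context: $\mathbb{R}^+ = \{a \in \mathbb{R} : a \ge 0\}$ and $\mathcal{C}_d$ is the family of convex sets in $\mathbb{R}^d$. For a family $A$ of sets, $\bigcap A$ is the intersection of its members. A function $f : \mathcal{C}_d \to \mathbb{R}^+ \cup \{\infty\}$ is monotone if $A \subset B$ implies $f(A) \le f(B)$; it is well-defined if $f(\emptyset) = 0$ and $f(B) \in \{0,\infty\}$ for any unbounded convex set $B$. Continuity of $f$ is with respect to the topology induced by the Hausdorff metric on convex sets. $f$ admits a Helly theorem if, given $1 > \varepsilon > 0$, there is an integer $H(f,d,\varepsilon)$ such that for any finite family $\mathcal{F}$ of convex sets in $\mathbb{R}^d$ and any $\lambda > 0$, if every subfamily $\mathcal{F}'$ of cardinality at most $H(f,d,\varepsilon)$ satisfies $f(\bigcap \mathcal{F}') \ge \lambda$, then $f(\bigcap \mathcal{F})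 \ge (1-\varepsilon)\lambda$. There is a floating body for a monotone function $f$ if for every $1 > \varepsilon > 0$ there is a $\delta = \delta(\varepsilon) > 0$ such that for any convex set $K$ with $f(K) < \infty$ there is a convex set $K(f,\varepsilon)$ such that: (i) $f(K(f,\varepsilon)) \ge (1-\delta)f(K)$, and (ii) for any convex set $A$, if $f(A \cap K) \ge (1-\varepsilon)f(K)$, then $K(f,\varepsilon) \subset A$. Moreover, it is required that $\delta(\varepsilon) \to 0$ as $\varepsilon \to 0$. (The function $\delta$ depends on $f$ and $d$, which are fixed.)
   Formalization: Continuity means Hausdorff continuity at bounded convex sets plus f(K ∩ B_r) → f(K) as r → ∞ for unbounded K (without such a link the claim fails for some f jumping to ∞ on unbounded sets); color classes are assumed nonempty. *)

(* Defs.v *)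
From HB Require Import structures.
From mathcomp Require Import all_boot all_order all_algebra.
From mathcomp Require Import all_classical all_reals all_analysis.

Set Implicit Arguments.
Unset Strict Implicit.
Unset Printing Implicit Defensive.

Import Order.TTheory GRing.Theory Num.Theory.
Import numFieldNormedType.Exports.

Local Open Scope classical_set_scope.
Local Open Scope ring_scope.

(** A function [C_d -> R^+ U {oo}] on the convex sets of R^d is represented by
    a function [f : set 'rV[R]_d -> \bar R] on all sets; every predicate below
    only looks at the values of [f] on convex sets. *)

Section Euclidean.
Context {R : realType} {d : nat}.
Implicit Types (x : 'rV[R]_d) (A B : set 'rV[R]_d).

(* The library norm on ['rV[R]_d] is the sup norm. *)
Definition enorm x : R := Num.sqrt (\sum_(i < d) x 0 i ^+ 2).

Definition eball (r : R) : set 'rV[R]_d := [set x | enorm x <= r].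

Definition edist_to B x : \bar R := ereal_inf [set (enorm (x - y))%:E | y in B].

(* Extended-valued: a nonempty set is at distance +oo from set0, so set0 is
   isolated. A pseudometric on sets that need not be closed. *)
Definition hausdorff_dist A B : \bar R :=
  Order.max (ereal_sup [set edist_to B x | x in A])
            (ereal_sup [set edist_to A y | y in B]).

End Euclidean.

Section SetFunctions.
Context {R : realType} {d : nat}.
Implicit Types (f : set 'rV[R]_d -> \bar R) (A B K L : set 'rV[R]_d).

Definition convex_nonneg f := forall K, convex_set K -> (0 <= f K)%E.

Definition convex_monotone f :=
  forall A B, convex_set A -> convex_set B -> A `<=` B -> (f A <= f B)%E.

Definition well_defined f :=
  f set0 = 0%E /\
  forall B, convex_set B -> ~ bounded_set B -> f B = 0%E \/ f B = +oo%E.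

(* The Hausdorff metric is a metric (up to closure) on bounded sets, and on
   them continuity is continuity for it. An unbounded set is at infinite
   Hausdorff distance from every bounded one, and e.g. the volume is not
   continuous at a ray for the extended Hausdorff distance; continuity at an
   unbounded set means that its bounded truncations approximate it. Without
   that clause the values of [f] on unbounded sets would be unrelated to those
   on bounded sets. *)
Definition hausdorff_continuous f :=
  (forall K, convex_set K -> bounded_set K ->
     forall U : set (\bar R), nbhs (f K) U ->
     exists2 eta : R, 0 < eta &
       forall L, convex_set L -> (hausdorff_dist K L < eta%:E)%E -> U (f L)) /\
  (forall K, convex_set K -> ~ bounded_set K ->
     f (K `&` eball r) @[r --> +oo] --> f K).

(* [G] may be empty, and the intersection of the empty family is the whole
   space. *)
Definition helly_number f (eps : R) (h : nat) :=
  forall (F : set (set 'rV[R]_d)) (lambda : R),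
    finite_set F -> (forall A, F A -> convex_set A) -> 0 < lambda ->
    (forall G : set (set 'rV[R]_d), G `<=` F -> (G #<= `I_h)%card ->
       (lambda%:E <= f (\bigcap_(A in G) A))%E) ->
    (((1 - eps) * lambda)%:E <= f (\bigcap_(A in F) A))%E.

Definition admits_helly f (H : R -> nat) :=
  forall eps : R, 0 < eps < 1 -> helly_number f eps (H eps).

Definition is_floating_body f (eps delta : R) K L :=
  [/\ convex_set L,
      ((1 - delta)%:E * f K <= f L)%E &
      forall A, convex_set A ->
        ((1 - eps)%:E * f K <= f (A `&` K))%E -> L `<=` A].

Definition has_floating_body f (delta : R -> R) :=
  (forall eps : R, 0 < eps < 1 ->
     0 < delta eps /\
     forall K, convex_set K -> (f K < +oo)%E ->
       exists L, is_floating_body f eps (delta eps) K L) /\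
  delta eps @[eps --> 0^'+] --> 0.

End SetFunctions.

(* Main.v *)
Require Import Defs.
From mathcomp Require Import all_boot all_order all_algebra.
From mathcomp Require Import all_classical all_reals all_analysis.
From mathcomp Require Import ring lra.
Set Implicit Arguments.
Unset Strict Implicit.
Unset Printing Implicit Defensive.

Import Order.TTheory GRing.Theory Num.Theory.
Import numFieldNormedType.Exports.
Local Open Scope classical_set_scope.
Local Open Scope ring_scope.

(** Since [f] is monotone, it is enough to find a convex set [L] with [f L] close
    to [1 - delta eps] or larger that lies in all members of one colour class.

    Suppose first that all sets are closed, and fix [lam < 1].  For a colour
    [k] and a choice [w] of one set in each class, let [K k w] be the
    intersection of the chosen sets of all colours except [k]; it satisfies
    [f (K k w) > lam].  Let [r] be the least radius for which all the truncated
    sets [K k w `&` eball r] satisfy [f >= lam] ([critical_radius]).  It exists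
    because [f] of a closed set truncated to a ball depends
    right-continuously on the radius, and some pair [(k, w)] is extremal:
    each smaller ball cuts [f] below [lam].  Put [A := K k w `&` eball r].

    For each set [C] of colour [k] consider the [h + 1] sets formed by [C], the
    ball and the [h - 1] sets that define [K k w].  Dropping the ball leaves a
    colourful choice; dropping any other set leaves, inside the ball, a set
    [K k' w'].  So the intersection of any [h] of them has [f >= lam], and the
    Helly property gives [f (C `&` A) >= (1 - eps) * lam] ([helly_recolor]).  It
    remains to find one large convex set inside all such [C].
    - If [K k w] meets the open ball, [f] is also left-continuous at [r], so
      [f A = lam] and the last bound says that each [C] captures a fraction
      [1 - eps] of [A].  Hence the floating body of [A] lies in every [C].
    - Otherwise [A] is a single point, by strict convexity of the ball; each
      [C] meets [A], so it contains [A].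

    For sets that are not closed, the intersections of closures may be larger
    than those of the sets.  Instead each class is shrunk: every colourful
    intersection contains a finite set of points whose hull has [f > lam], and
    a member [C] is replaced by the hull of the points that come from the
    choices using [C] ([colorful_convex]).  Finally [lam] tends to 1; since
    there are finitely many classes, a single [lam] close enough to 1 refutes
    the negation of the conclusion. *)

(** * Convex sets *)

Section ConvexSets.
Context {R : realType} {V : lmodType R}.
Implicit Types (A B : set V) (x y : V).

Lemma convex_setP A : convex_set A <->
  forall x y (t : R), A x -> A y -> 0 <= t <= 1 -> A ((1 - t) *: x + t *: y).
Proof.
split=> [cA x y t Ax Ay t01|cA x y t].
  have := cA y x (Itv01 (andP t01).1 (andP t01).2).
  by rewrite !inE addrC => /(_ Ay Ax).
rewrite !inE => Ax Ay; rewrite /conv/= addrC; apply: cA => //.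
by rewrite ge0 le1.
Qed.

Lemma convex_setI A B : convex_set A -> convex_set B -> convex_set (A `&` B).
Proof.
move=> /convex_setP cA /convex_setP cB; apply/convex_setP.
move=> x y t [Ax Bx] [Ay By] t01.
by split; [exact: cA|exact: cB].
Qed.

Lemma convex_bigcap (I : Type) (D : set I) (A : I -> set V) :
  (forall i, D i -> convex_set (A i)) -> convex_set (\bigcap_(i in D) A i).
Proof.
move=> cA; apply/convex_setP => x y t Ax Ay t01 i Di.
by move/convex_setP : (cA i Di); apply; [exact: Ax|exact: Ay|].
Qed.

Lemma convex_set0 : convex_set (set0 : set V).
Proof. by apply/convex_setP => x y t []. Qed.

(** Induction on the number of points: the point of index 0 is split off and
    the other weights are renormalised by their sum [s], unless [s = 0]. *)
Lemma convex_set_sum A n (w : 'I_n -> R) (x : 'I_n -> V) :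
  convex_set A -> (forall i, A (x i)) -> (forall i, 0 <= w i) ->
  \sum_i w i = 1 -> A (\sum_i w i *: x i).
Proof.
move=> /convex_setP cA; elim: n w x => [|n IHn] w x Ax w0 w1.
  by move: w1; rewrite big_ord0 => /esym/eqP; rewrite oner_eq0.
move: w1; rewrite !big_ord_recl => w1.
set s := \sum_(i < n) _ in w1.
have s0 : 0 <= s by exact: sumr_ge0.
have [sE|sN0] := eqVneq s 0.
  have -> : w ord0 = 1 by rewrite -w1 sE addr0.
  rewrite scale1r big1 ?addr0 // => i _.
  by have /psumr_eq0P -> // := sE; rewrite scale0r.
have -> : w ord0 = 1 - s by apply/eqP; rewrite eq_sym subr_eq w1.
have -> : \sum_(i < n) w (lift ord0 i) *: x (lift ord0 i) =
    s *: \sum_(i < n) (w (lift ord0 i) / s) *: x (lift ord0 i).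
  by rewrite scaler_sumr; apply: eq_bigr => i _; rewrite scalerA mulrCA divff // mulr1.
apply: cA => //; last by apply/andP; split=> //; rewrite -w1 lerDr.
apply: IHn => [//|i|]; first by rewrite divr_ge0.
by rewrite -mulr_suml divff.
Qed.

End ConvexSets.

(** * The Euclidean norm *)

Section EuclideanNorm.
Context {R : realType} {d : nat}.
Implicit Types (x y : 'rV[R]_d) (r t : R).

Lemma enorm_ge0 x : 0 <= enorm x.
Proof. exact: sqrtr_ge0. Qed.

Lemma sqr_enorm x : enorm x ^+ 2 = \sum_(i < d) x 0 i ^+ 2.
Proof. by rewrite sqr_sqrtr // sumr_ge0 // => i _; exact: sqr_ge0. Qed.

Lemma enorm_le_sqr x r : 0 <= r -> (enorm x <= r) = (enorm x ^+ 2 <= r ^+ 2).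
Proof. by move=> r0; rewrite ler_sqr ?nnegrE ?enorm_ge0. Qed.

Lemma enorm_lt_sqr x r : 0 <= r -> (enorm x < r) = (enorm x ^+ 2 < r ^+ 2).
Proof. by move=> r0; rewrite ltr_sqr ?nnegrE ?enorm_ge0. Qed.

Lemma enormN x : enorm (- x) = enorm x.
Proof.
by congr Num.sqrt; apply: eq_bigr => i _; rewrite mxE sqrrN.
Qed.

Lemma enorm0 : enorm (0 : 'rV[R]_d) = 0.
Proof.
by rewrite /enorm big1 ?sqrtr0 // => i _; rewrite mxE expr0n.
Qed.

Lemma enorm_eq0 x : enorm x = 0 -> x = 0.
Proof.
move=> x0; have := sqr_enorm x; rewrite x0 expr0n /= => /esym.
move=> /psumr_eq0P x00; apply/rowP => i; rewrite mxE.
by apply/eqP; rewrite -sqrf_eq0 x00 // => j _; exact: sqr_ge0.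
Qed.

Lemma enorm_scale t x : 0 <= t -> enorm (t *: x) = t * enorm x.
Proof.
move=> t0; apply/eqP; rewrite -(@eqrXn2 _ 2) ?enorm_ge0 ?mulr_ge0 ?enorm_ge0 //.
rewrite exprMn !sqr_enorm mulr_sumr; apply/eqP/eq_bigr => i _.
by rewrite mxE exprMn.
Qed.

(** The defect term makes the square of the norm strictly convex; the
    convexity facts about the norm come from this identity, which also stands in for the
    triangle inequality. *)
Lemma sqr_enorm_conv x y t :
  enorm ((1 - t) *: x + t *: y) ^+ 2 =
  (1 - t) * enorm x ^+ 2 + t * enorm y ^+ 2 - t * (1 - t) * enorm (x - y) ^+ 2.
Proof.
rewrite !sqr_enorm !mulr_sumr -sumrN -!big_split/=.
by apply: eq_bigr => i _; rewrite !mxE; ring.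
Qed.

(** By the identity above at the midpoint, whose squared norm is nonnegative. *)
Lemma enormB_le x y r : enorm x <= r -> enorm y <= r -> enorm (x - y) <= 2 * r.
Proof.
move=> xr yr; have r0 : 0 <= r := le_trans (enorm_ge0 x) xr.
rewrite enorm_le_sqr ?mulr_ge0 //.
have : enorm (2^-1 *: x + 2^-1 *: y) ^+ 2 >= 0 by exact: sqr_ge0.
have -> : 2^-1 *: x = (1 - 2^-1) *: x by congr (_ *: _); field.
rewrite sqr_enorm_conv.
move: xr yr; rewrite !enorm_le_sqr //.
by move: (enorm x) (enorm y) (enorm _) => a b c; nra.
Qed.

Lemma convex_eball r : convex_set (eball r : set 'rV[R]_d).
Proof.
apply/convex_setP => x y t /= xr yr /andP[t0 t1].
have r0 : 0 <= r := le_trans (enorm_ge0 x) xr.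
rewrite /eball /= enorm_le_sqr // sqr_enorm_conv.
have : 0 <= t * (1 - t) * enorm (x - y) ^+ 2.
  by rewrite mulr_ge0 ?sqr_ge0 // mulr_ge0 // subr_ge0.
move: xr yr; rewrite /eball/= !enorm_le_sqr //.
by move: (enorm x) (enorm y) (enorm _) => a b c; nra.
Qed.

Lemma continuous_enorm : continuous (@enorm R d).
Proof.
move=> x; apply: continuous_comp; last exact: sqrt_continuous.
apply: (@continuous_big R 'I_d +%R 0 xpredT) => [[u v]|i _ y].
  by apply: cvgD; [exact: cvg_fst|exact: cvg_snd].
have ci : continuous (fun z : 'rV[R]_d => z 0 i : R) by exact: coord_continuous.
exact: (continuousM (ci y) (ci y)).
Qed.

Lemma continuous_enormB y : continuous (fun x => enorm (x - y)).
Proof.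
move=> x; apply: (@continuous_comp _ _ _ (fun x => x - y) (@enorm R d)).
  have ci : continuous (@id 'rV[R]_d) by move=> z; exact: cvg_id.
  have cc : continuous (cst y : 'rV[R]_d -> 'rV[R]_d) by exact: cst_continuous.
  exact: (cvgB (ci x) (cc x)).
exact: continuous_enorm.
Qed.

Lemma coord_le_enorm x i : `|x 0 i| <= enorm x.
Proof.
rewrite -(ler_pXn2r (ltn0Sn 1)) ?nnegrE ?enorm_ge0 // sqr_enorm real_normK ?num_real //.
by rewrite (bigD1 i) //= lerDl sumr_ge0 // => j _; exact: sqr_ge0.
Qed.

Lemma norm_le_enorm x : `|x| <= enorm x.
Proof.
rewrite [leLHS]/Num.norm/= mx_normrE; apply: bigmax_le => [|[i j] _] /=.
  exact: enorm_ge0.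
by rewrite ord1 coord_le_enorm.
Qed.

Lemma bounded_setP (A : set 'rV[R]_d) :
  bounded_set A <-> exists2 r, 0 <= r & A `<=` eball r.
Proof.
split.
  move=> [M [_ AM]]; pose m := `|M| + 1.
  have m0 : 0 <= m by rewrite addr_ge0.
  exists (Num.sqrt (\sum_(i < d) m ^+ 2)); first exact: sqrtr_ge0.
  move=> x Ax; rewrite /eball /= /enorm ler_wsqrtr // ler_sum // => i _.
  rewrite -[leLHS]real_normK ?num_real // ler_sqr ?nnegrE //.
  have xm : `|x| <= m.
    by apply: (AM m) => //; rewrite (le_lt_trans (ler_norm M)) // ltrDl.
  apply: le_trans xm; rewrite [leRHS]/Num.norm/= mx_normrE.
  by apply: (@le_bigmax _ _ _ 0 (fun ij => `|x ij.1 ij.2|) (0, i)).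
move=> [r r0 Ar]; exists r; split; first exact: num_real.
move=> M rM x Ax /=; apply: (le_trans (norm_le_enorm x)).
exact: le_trans (Ar x Ax) (ltW rM).
Qed.

Lemma closed_eball r : closed (eball r : set 'rV[R]_d).
Proof.
exact: (continuous_closedP _).1 continuous_enorm _ (@closed_le R r).
Qed.

Lemma compact_eball r : compact (eball r : set 'rV[R]_d).
Proof.
apply: bounded_closed_compact (@closed_eball r).
apply/bounded_setP; exists `|r| => // x; rewrite /eball/= => xr.
exact: le_trans xr (ler_norm r).
Qed.

End EuclideanNorm.

(** * Balls, nets and continuity of set functions *)

Section Continuity.
Context {R : realType} {d : nat}.
Implicit Types (K L A B T : set 'rV[R]_d) (r lam e : R).

Lemma hausdorff_dist_le A B e :
  (forall x, A x -> exists2 y, B y & enorm (x - y) <= e) ->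
  (forall y, B y -> exists2 x, A x & enorm (y - x) <= e) ->
  (hausdorff_dist A B <= e%:E)%E.
Proof.
have dist_le C x : (exists2 y, C y & enorm (x - y) <= e) -> (edist_to C x <= e%:E)%E.
  move=> [y Cy ye]; apply: (@le_trans _ _ (enorm (x - y))%:E); last by rewrite lee_fin.
  by apply: ereal_inf_lbound; exists y.
move=> AB BA; rewrite /hausdorff_dist ge_max; apply/andP.
by split; apply: ge_ereal_sup => _ [x /= Ax <-]; apply: dist_le; [exact: AB|exact: BA].
Qed.

Lemma setI_eball_le K r r' : r <= r' -> K `&` eball r `<=` K `&` eball r'.
Proof. by move=> rr' x [Kx xr]; split => //; exact: le_trans xr rr'. Qed.

Lemma bounded_setI_eball K r : bounded_set (K `&` eball r).
Proof.
apply/bounded_setP; exists `|r| => // x [_ xr].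
exact: le_trans xr (ler_norm r).
Qed.

(** The points of [K] in the ball of radius [r + 1] that are far from
    [K `&` eball r] form a compact set, on which the norm has a minimum; that
    minimum exceeds [r]. *)
Lemma setI_eball_near K r e : closed K -> 0 < e ->
  exists2 r', r < r' & forall x, K x -> enorm x <= r' ->
    exists2 y, (K `&` eball r) y & enorm (x - y) <= e.
Proof.
move=> clK e0.
pose far := [set x | forall y, (K `&` eball r) y -> e <= enorm (x - y)].
have clfar : closed far.
  have -> : far = \bigcap_(y in K `&` eball r) [set x | e <= enorm (x - y)] by [].
  apply: closed_bigI => y _.
  exact: (continuous_closedP _).1 (@continuous_enormB _ _ y) _ (@closed_ge R e).
have cptC : compact (eball (r + 1) `&` (K `&` far)).
  by apply: compact_closedI; [exact: compact_eball|exact: closedI].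
have [rho rrho Crho] : exists2 rho, r < rho &
    forall x, (eball (r + 1) `&` (K `&` far)) x -> rho <= enorm x.
  have [C0|C0] := eqVneq (eball (r + 1) `&` (K `&` far)) set0.
    by exists (r + 1); [rewrite ltrDl|rewrite C0].
  have /set0P C0' := C0.
  have [|c] := compact_EVT_min C0' cptC (f := @enorm R d).
    by apply: continuous_subspaceT; exact: continuous_enorm.
  rewrite inE => -[_ [Kc farc]] minc; exists (enorm c); last first.
    by move=> x Cx; apply: minc; rewrite inE.
  rewrite ltNge; apply/negP => cr.
  by have := farc c (conj Kc cr); rewrite subrr enorm0 leNgt e0.
exists (Num.min (r + 1) ((r + rho) / 2)); first by rewrite lt_min; apply/andP; split; lra.
move=> x Kx; rewrite le_min => /andP[x1 x2].
apply: contrapT => noy; have : rho <= enorm x; last by lra.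
apply: Crho; split => //; split => // y yKr.
by rewrite leNgt; apply/negP => /ltW xy; apply: noy; exists y.
Qed.

(** Contract [K `&` eball r] towards [p] by a small factor [t]: by convexity of
    the squared norm all contracted points lie in one ball of radius [< r]. *)
Lemma setI_eball_dense K r e p : convex_set K -> K p -> enorm p < r -> 0 < e ->
  exists2 r', r' < r & forall x, (K `&` eball r) x ->
    exists2 y, (K `&` eball r') y & enorm (x - y) <= e.
Proof.
move=> /convex_setP cK Kp pr e0.
have r0 : 0 < r := le_lt_trans (enorm_ge0 p) pr.
(* A contraction by [t] moves points by at most [t * (2 * r)], which has to be
   at most [e] with [t < 1]. *)
pose t := e / (e + 2 * r).
have t0 : 0 < t by rewrite divr_gt0 // addr_gt0 // mulr_gt0.
have t1 : t < 1 by rewrite ltr_pdivrMr; lra.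
have te : t * (2 * r) <= e.
  by rewrite mulrAC ler_pdivrMr; [nra|lra].
pose s := (1 - t) * r ^+ 2 + t * enorm p ^+ 2.
have s0 : 0 <= s by rewrite addr_ge0 // mulr_ge0 ?sqr_ge0 ?subr_ge0 // ltW.
exists (Num.sqrt s).
  rewrite -(@ltr_pXn2r _ 2) ?nnegrE ?sqrtr_ge0 // ?ltW // (sqr_sqrtr s0).
  by move: pr; rewrite (enorm_lt_sqr _ (ltW r0)) /s; nra.
move=> x [Kx xr]; exists ((1 - t) *: x + t *: p).
  split; first by apply: cK => //; rewrite !ltW.
  rewrite /eball/= enorm_le_sqr ?sqrtr_ge0 // (sqr_sqrtr s0) sqr_enorm_conv.
  have : 0 <= t * (1 - t) * enorm (x - p) ^+ 2.
    have t1' : 0 <= 1 - t by rewrite subr_ge0 ltW.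
    by rewrite mulr_ge0 ?sqr_ge0 // mulr_ge0 // ltW.
  move: xr; rewrite /eball/= (enorm_le_sqr _ (ltW r0)) /s.
  by move: (enorm x ^+ 2) (r ^+ 2) => a b; nra.
have -> : x - ((1 - t) *: x + t *: p) = t *: (x - p).
  by rewrite scalerBl scale1r scalerBr; apply/rowP => i; rewrite !mxE; ring.
rewrite (enorm_scale _ (ltW t0)); apply: le_trans te.
by rewrite ler_pM2l // enormB_le //; exact: ltW.
Qed.

Lemma finite_net T e : bounded_set T -> 0 < e ->
  exists2 s : seq 'rV[R]_d, (forall x, x \in s -> T x) &
    forall x, T x -> exists2 y, y \in s & enorm (x - y) <= e.
Proof.
move=> /bounded_setP[r r0 Tr] e0.
have cptT : compact (closure T).
  apply: subclosed_compact (@closed_closure _ T) (@compact_eball R d r) _.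
  by move=> x /(closure_subset Tr) /(@closed_eball R d r).
move: cptT; rewrite compact_cover => /(_ _ T (fun y => [set x | enorm (x - y) < e])).
have opn (y : 'rV[R]_d) : open [set x | enorm (x - y) < e].
  exact: (continuousP _).1 (@continuous_enormB _ _ y) _ (@open_lt R e).
case=> [//| |D DT TD].
  move=> z clTz; have [] := clTz [set x | enorm (x - z) < e].
    by apply: open_nbhs_nbhs; split=> //=; rewrite subrr enorm0.
  by move=> y [Ty yz]; exists y => //=; rewrite -opprB enormN.
exists (finmap.enum_fset D) => [x xD|x Tx].
  by have := DT x xD; rewrite inE.
by have [y yD /= /ltW xy] := TD x (subset_closure Tx); exists y.
Qed.

Section Function.
Context (f : set 'rV[R]_d -> \bar R) (f_cont : hausdorff_continuous f).

Lemma continuous_gt K lam : convex_set K -> bounded_set K -> (lam%:E < f K)%E ->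
  exists2 e, 0 < e & forall L, convex_set L ->
    (forall x, K x -> exists2 y, L y & enorm (x - y) <= e) ->
    (forall y, L y -> exists2 x, K x & enorm (y - x) <= e) -> (lam%:E < f L)%E.
Proof.
move=> cK bK lamK; have [//|eta eta0 etaP] := f_cont.1 K cK bK [set x | (lam%:E < x)%E].
  by apply: open_nbhs_nbhs; split => //; exact: open_ereal_gt_ereal.
exists (eta / 2); first by rewrite divr_gt0.
move=> L cL KL LK; apply: etaP => //.
by apply: le_lt_trans (hausdorff_dist_le KL LK) _; rewrite lte_fin; lra.
Qed.

Lemma continuous_lt K lam : convex_set K -> bounded_set K -> (f K < lam%:E)%E ->
  exists2 e, 0 < e & forall L, convex_set L ->
    (forall x, K x -> exists2 y, L y & enorm (x - y) <= e) ->
    (forall y, L y -> exists2 x, K x & enorm (y - x) <= e) -> (f L < lam%:E)%E.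
Proof.
move=> cK bK lamK; have [//|eta eta0 etaP] := f_cont.1 K cK bK [set x | (x < lam%:E)%E].
  by apply: open_nbhs_nbhs; split => //; exact: open_ereal_lt_ereal.
exists (eta / 2); first by rewrite divr_gt0.
move=> L cL KL LK; apply: etaP => //.
by apply: le_lt_trans (hausdorff_dist_le KL LK) _; rewrite lte_fin; lra.
Qed.

(** For an unbounded [K] this is the clause of continuity at infinity; a
    bounded one is equal to one of its truncations. *)
Lemma truncation_gt K lam : convex_set K -> (lam%:E < f K)%E ->
  exists r, (lam%:E < f (K `&` eball r))%E.
Proof.
move=> cK lamK; have [bK|nbK] := pselect (bounded_set K).
  have /bounded_setP[r _ Kr] := bK; exists r; rewrite setIidl //.
have nlam : nbhs (f K) [set x | (lam%:E < x)%E].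
  by apply: open_nbhs_nbhs; split => //; exact: open_ereal_gt_ereal.
have [r] := @filter_ex R (pinfty_nbhs R) _ _ (f_cont.2 K cK nbK _ nlam).
by exists r.
Qed.

(** Closedness matters when [K] only touches the closed ball: an open [K] could
    have an empty truncation at [r] and nonempty ones at all larger radii. *)
Lemma truncation_right_continuous K r lam : convex_set K -> closed K ->
  (f (K `&` eball r) < lam%:E)%E ->
  exists2 r', r < r' & (f (K `&` eball r') < lam%:E)%E.
Proof.
move=> cK clK Klam; have cKr r' := convex_setI cK (@convex_eball R d r').
have [e e0 eP] := continuous_lt (cKr r) (@bounded_setI_eball K r) Klam.
have [r' rr' r'P] := setI_eball_near r clK e0.
exists r' => //; apply: eP => // [x Kx|y [Ky yr']]; last exact: r'P.
by exists x; [exact: setI_eball_le (ltW rr') _ Kx|rewrite subrr enorm0 ltW].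
Qed.

(** The point [p] matters when [K] only touches the closed ball: then the
    smaller truncations are empty. *)
Lemma truncation_left_continuous K r lam p : convex_set K -> K p -> enorm p < r ->
  (lam%:E < f (K `&` eball r))%E ->
  exists2 r', r' < r & (lam%:E < f (K `&` eball r'))%E.
Proof.
move=> cK Kp pr Klam; have cKr r' := convex_setI cK (@convex_eball R d r').
have [e e0 eP] := continuous_gt (cKr r) (@bounded_setI_eball K r) Klam.
have [r' rr' r'P] := setI_eball_dense cK Kp pr e0.
exists r' => //; apply: eP => // y Ky.
by exists y; [exact: setI_eball_le (ltW rr') _ Ky|rewrite subrr enorm0 ltW].
Qed.

(** The points of a fine enough finite net force every convex set between them
    and [T] to be close to [T] in the Hausdorff metric. *)
Lemma finite_subset_gt T lam : convex_set T -> bounded_set T -> (lam%:E < f T)%E ->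
  exists2 s : seq 'rV[R]_d, (forall x, x \in s -> T x) &
    forall L, convex_set L -> L `<=` T -> (forall x, x \in s -> L x) ->
      (lam%:E < f L)%E.
Proof.
move=> cT bT Tlam; have [e e0 eP] := continuous_gt cT bT Tlam.
have [s sT sP] := finite_net bT e0.
exists s => // L cL LT sL; apply: eP => // [x /sP[y ys xy]|y /LT Ty].
  by exists y => //; exact: sL.
by exists y; rewrite // subrr enorm0 ltW.
Qed.

End Function.
End Continuity.

(** * Convex hulls of finite sets *)

Section Hull.
Context {R : realType} {d : nat}.
Implicit Types (s : seq 'rV[R]_d).

Definition simplex n : set 'rV[R]_n :=
  [set w | (forall i, 0 <= w 0 i) /\ \sum_i w 0 i = 1].

Arguments simplex : clear implicits.

Definition hull s : set 'rV[R]_d :=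
  [set \sum_(i < size s) w 0 i *: s`_i | w in simplex (size s)].

Lemma mem_hull s x : x \in s -> hull s x.
Proof.
move=> xs; have xi : (index x s < size s)%N by rewrite index_mem.
have dE (i : 'I_(size s)) : (delta_mx 0 (Ordinal xi) : 'rV[R]_(size s)) 0 i =
    (i == Ordinal xi)%:R by rewrite mxE eqxx.
exists (delta_mx 0 (Ordinal xi)).
  split=> [i|]; first by rewrite dE.
  rewrite (bigD1 (Ordinal xi)) //= dE eqxx big1 ?addr0 // => i /negPf ni.
  by rewrite dE ni.
rewrite (bigD1 (Ordinal xi)) //= dE eqxx big1 ?addr0 => [|i /negPf ni].
  by rewrite scale1r nth_index.
by rewrite dE ni scale0r.
Qed.

Lemma hull_sub s (A : set 'rV[R]_d) :
  convex_set A -> (forall x, x \in s -> A x) -> hull s `<=` A.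
Proof.
move=> cA sA _ [w [w0 w1] <-]; apply: convex_set_sum => // i.
by apply: sA; exact: mem_nth.
Qed.

Lemma convex_hull s : convex_set (hull s).
Proof.
apply/convex_setP => _ _ t [u [u0 u1] <-] [v [v0 v1] <-] /andP[t0 t1].
exists ((1 - t) *: u + t *: v).
  split=> [i|]; first by rewrite !mxE addr_ge0 // mulr_ge0 // subr_ge0.
  under eq_bigr do rewrite !mxE.
  by rewrite big_split/= -!mulr_sumr u1 v1 !mulr1 subrK.
rewrite !scaler_sumr -big_split/=; apply: eq_bigr => i _.
by rewrite !mxE !scalerA -scalerDl.
Qed.

Lemma compact_simplex n : compact (simplex n).
Proof.
have ci (i : 'I_n) : continuous (fun w : 'rV[R]_n => w 0 i : R).
  exact: coord_continuous.
apply: subclosed_compact (@compact_eball R n 1) _; last first.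
  move=> w [w0 w1]; rewrite /eball/= enorm_le_sqr // sqr_enorm expr1n -w1.
  apply: ler_sum => i _; rewrite expr2 ler_piMr // -w1 (bigD1 i) //= lerDl.
  by apply: sumr_ge0.
have -> : simplex n = (\bigcap_i [set w : 'rV[R]_n | 0 <= w 0 i]) `&`
    [set w : 'rV[R]_n | \sum_i w 0 i = 1].
  by apply/seteqP; split=> w [w0 w1]; split => // i; [move=> _|]; exact: w0.
apply: closedI.
  apply: closed_bigI => i _.
  exact: (continuous_closedP _).1 (ci i) _ (@closed_ge R 0).
have cs : continuous (fun w : 'rV[R]_n => \sum_i w 0 i : R).
  apply: (@continuous_big R 'I_n +%R 0 xpredT) => [[u v]|i _]; last exact: ci.
  by apply: cvgD; [exact: cvg_fst|exact: cvg_snd].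
exact: (continuous_closedP _).1 cs _ (@closed_eq R 1).
Qed.

(** The hull is the image of the compact simplex under a continuous map. *)
Lemma closed_hull s : closed (hull s).
Proof.
apply: compact_closed; first exact: norm_hausdorff.
apply: continuous_compact (@compact_simplex _).
apply: continuous_subspaceT.
apply: (@continuous_big 'rV[R]_d 'I_(size s) +%R 0 xpredT) => [[u v]|i _ w].
  by apply: cvgD; [exact: cvg_fst|exact: cvg_snd].
have ci : continuous (fun w : 'rV[R]_(size s) => w 0 i : R).
  exact: coord_continuous.
exact: (cvgZr_tmp (ci w)).
Qed.

End Hull.

(** * Finite choices and the Helly property *)

(** A finite number of thresholds, all taken in [D], has a maximum, which is
    again in [D]; an arbitrary element of [D] serves for an empty [T]. *)
Lemma finite_common_bound {R : realType} (T : finType) (D : set R)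
    (P : T -> R -> Prop) :
  D !=set0 -> (forall t r r', r <= r' -> P t r -> P t r') ->
  (forall t, exists2 r, D r & P t r) -> exists2 r, D r & forall t, P t r.
Proof.
move=> [r0 Dr0] Pup /(_ _)/cid2-/all_sig2[g Dg Pg].
exists (\big[Num.max/r0]_t g t).
  by elim/big_ind : _ => // x y Dx Dy; rewrite maxEle; case: ifP.
by move=> t; apply: Pup (Pg t); exact: (le_bigmax r0 g t).
Qed.

Section Helly.
Context {R : realType} {d : nat} (f : set 'rV[R]_d -> \bar R).
Context (f_mono : convex_monotone f).

(** A subfamily of at most [h] members has at most [h] chosen indices, so it
    misses an index [k], and its intersection contains the one that omits [k].
    Working with indices covers the case where some of the sets coincide. *)
Lemma helly_omit_one eps h (E : 'I_h.+1 -> set 'rV[R]_d) (lam : R) :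
  helly_number f eps h -> (forall k, convex_set (E k)) -> 0 < lam ->
  (forall k, (lam%:E <= f (\bigcap_(j in [set j | j != k]) E j))%E) ->
  (((1 - eps) * lam)%:E <= f (\bigcap_j E j))%E.
Proof.
move=> helly cE lam0 E_omit.
have := helly (range E) lam; rewrite bigcap_image; apply=> //.
- by apply: finite_image; exact: finite_finset.
- by move=> _ [k _ <-].
move=> G GE Gh.
have /choice[g gP] : forall A, exists k, G A -> E k = A.
  move=> A; have [GA|nGA] := pselect (G A); last by exists ord0.
  by have [k _ <-] := GE A GA; exists k.
have [k gk] : exists k, ~ (g @` G) k.
  apply/existsNP => allg; have : (`I_h.+1 #<= `I_h)%card.
    rewrite (card_le_eql card_II); apply: card_le_trans Gh.
    apply: card_le_trans (card_image_le g G); apply: subset_card_le.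
    by move=> k _; exact: allg.
  by rewrite card_le_II ltnn.
apply: le_trans (E_omit k) _; apply: f_mono.
- by apply: convex_bigcap => j _; exact: cE.
- by apply: convex_bigcap => A /GE[j _ <-]; exact: cE.
move=> x Ex A GA; rewrite -(gP A GA); apply: Ex => /=.
by apply/eqP => gAk; apply: gk; exists A.
Qed.

End Helly.

(** * The colourful theorem *)

Section Colorful.
Context {R : realType} {d : nat} (f : set 'rV[R]_d -> \bar R).
Context (f_set0 : f set0 = 0%E) (f_cont : hausdorff_continuous f).
Context (f_mono : convex_monotone f).
Context (eps delta : R) (h : nat) (f_helly : helly_number f eps h).
Context (eps1 : eps < 1) (delta0 : 0 < delta).
Context (f_float : forall K, convex_set K -> (f K < +oo)%E ->
  exists L, is_floating_body f eps delta K L).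
Context (J : finType) (i0 : 'I_h) (j0 : J) (lam : R) (lam0 : 0 < lam).

Definition omit_color (e : 'I_h -> J -> set 'rV[R]_d) k (w : {ffun 'I_h -> J}) :=
  \bigcap_(i in [set i | i != k]) e i (w i).

Section Closed.
Context (e : 'I_h -> J -> set 'rV[R]_d).
Context (e_conv : forall i j, convex_set (e i j)) (e_closed : forall i j, closed (e i j)).
Context (e_colorful : forall w : {ffun 'I_h -> J}, (lam%:E < f (\bigcap_i e i (w i)))%E).

Let convex_omit k w : convex_set (omit_color e k w).
Proof. by apply: convex_bigcap. Qed.

Let convex_omit_eball k w r : convex_set (omit_color e k w `&` eball r).
Proof. by apply: convex_setI => //; exact: convex_eball. Qed.

Let f_omit_eball_le k w r r' : r <= r' ->
  (f (omit_color e k w `&` eball r) <= f (omit_color e k w `&` eball r'))%E.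
Proof. by move=> rr'; apply: f_mono => //; exact: setI_eball_le. Qed.

(** The radius is an infimum.  It is attained by right-continuity; if no pair
    [(k, w)] were extremal, then finitely many smaller admissible radii, one
    for each pair, would have a common bound that is still smaller. *)
Lemma critical_radius : exists r k w,
  (forall k' w', (lam%:E <= f (omit_color e k' w' `&` eball r))%E) /\
  (forall r', r' < r -> (f (omit_color e k w `&` eball r') < lam%:E)%E).
Proof.
pose P (kw : 'I_h * {ffun 'I_h -> J}) r :=
  (lam%:E <= f (omit_color e kw.1 kw.2 `&` eball r))%E.
have Pup kw r r' : r <= r' -> P kw r -> P kw r'.
  by move=> rr' Pr; apply: le_trans Pr _; exact: f_omit_eball_le.
pose S := [set r | forall kw, P kw r].
have S_ne : S !=set0.
  have [|[k w]|r _ Sr] := @finite_common_bound R _ setT P _ Pup.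
  - by exists 0.
  - have [||r lamr] := truncation_gt f_cont (K := omit_color e k w) (lam := lam).
    + exact: convex_omit.
    + apply: lt_le_trans (e_colorful w) _; apply: f_mono => //.
        by apply: convex_bigcap.
      by move=> x ex i _; exact: ex.
    + by exists r => //; exact: ltW.
  - by exists r.
(* A ball of negative radius is empty, and [f set0 = 0 < lam]. *)
have S_lb : lbound S 0.
  move=> r Sr; rewrite leNgt; apply/negP => r0.
  have := Sr (i0, [ffun=> j0]); rewrite /P /=.
  have -> : omit_color e i0 [ffun=> j0] `&` eball r = set0.
    apply/seteqP; split=> // x [_ xr].
    by have := le_trans (enorm_ge0 x) xr; rewrite leNgt r0.
  by rewrite f_set0 lee_fin leNgt lam0.
have S_inf : has_inf S by split => //; exists 0.
have Pinf : S (inf S).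
  move=> [k w]; rewrite /P /= leNgt; apply/negP.
  have clK : closed (omit_color e k w) by apply: closed_bigI.
  move=> /(truncation_right_continuous f_cont (@convex_omit k w) clK)[r' rr' lamr'].
  have gap : 0 < r' - inf S by rewrite subr_gt0.
  have [r Sr] := inf_adherent gap S_inf; rewrite subrKC => /ltW rr.
  have : P (k, w) r' by exact: Pup rr (Sr _).
  by rewrite /P /= leNgt lamr'.
have [k [w kwP]] : exists k w, forall r, r < inf S -> ~ P (k, w) r.
  apply: contrapT => nkw.
  have [||r rS Sr] := @finite_common_bound R _ [set r | r < inf S] P _ Pup.
  - by exists (inf S - 1); rewrite /= gtrBl.
  - move=> [k w]; apply: contrapT => nr; apply: nkw; exists k, w => r rS Pr.
    by apply: nr; exists r.
  - by have := ge_inf S_inf.2 Sr; rewrite leNgt rS.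
exists (inf S), k, w; split=> [k' w'|r' /kwP/negP]; first exact: (Pinf (k', w')).
by rewrite -ltNge.
Qed.

(** The Helly property applied to the ball, the set [e k j] and the sets
    [e i (w i)] of the other colours, that is, to the choice [w'] that differs
    from [w] at [k] only. *)
Lemma helly_recolor r k w j :
  (forall k' w', (lam%:E <= f (omit_color e k' w' `&` eball r))%E) ->
  (((1 - eps) * lam)%:E <= f (e k j `&` (omit_color e k w `&` eball r)))%E.
Proof.
move=> rP; pose w' := [ffun i => if i == k then j else w i].
pose E (a : 'I_h.+1) := if unlift ord0 a is Some i then e i (w' i) else eball r.
have E0 : E ord0 = eball r by rewrite /E unlift_none.
have Elift i : E (lift ord0 i) = e i (w' i) by rewrite /E liftK.
have cE a : convex_set (E a).
  by case: (unliftP ord0 a) => [i|] ->; rewrite ?E0 ?Elift //; exact: convex_eball.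
apply: le_trans (helly_omit_one f_mono f_helly cE lam0 _) _ => [a|].
  case: (unliftP ord0 a) => [i|] ->.
    apply: le_trans (rP i w') _; apply: f_mono => //; first exact: convex_bigcap.
    move=> x [xw xr] b /=; case: (unliftP ord0 b) => [i'|] -> ; last by rewrite E0.
    by rewrite Elift (inj_eq lift_inj) => /xw.
  apply: le_trans (ltW (e_colorful w')) _; apply: f_mono; try exact: convex_bigcap.
  move=> x xw b /=; case: (unliftP ord0 b) => [i'|] ->; last by rewrite eqxx.
  by rewrite Elift => _; exact: xw.
apply: f_mono; first exact: convex_bigcap.
  exact: convex_setI.
move=> x xE; split; first by have := xE (lift ord0 k) I; rewrite Elift ffunE eqxx.
split; last by have := xE ord0 I; rewrite E0.
by move=> i /negPf /= ik; have := xE (lift ord0 i) I; rewrite Elift ffunE ik.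
Qed.

(** Interior case: a floating body of the extremal truncation lies in all sets
    of colour [k].  Tangential case: the truncation is a single point, which
    lies in all of them. *)
Lemma colorful_closed :
  exists i, (((1 - delta) * lam)%:E <= f (\bigcap_j e i j))%E.
Proof.
have [r [k [w [rP kwP]]]] := critical_radius.
exists k; set A := omit_color e k w `&` eball r.
have ckj : convex_set (\bigcap_j e k j) by apply: convex_bigcap.
have meet j : (((1 - eps) * lam)%:E <= f (e k j `&` A))%E := helly_recolor k w j rP.
have [[p [Kp pr]]|nop] := pselect (exists p, omit_color e k w p /\ enorm p < r).
  have fA : f A = lam%:E.
    apply/eqP; rewrite eq_le (rP k w) andbT leNgt; apply/negP => lamA.
    have [r' rr' lamr'] := truncation_left_continuous f_cont (@convex_omit k w) Kp pr lamA.
    by have := lt_trans lamr' (kwP r' rr'); rewrite ltxx.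
  have [|L [cL lamL LP]] := f_float (@convex_omit_eball k w r).
    by rewrite -/A fA ltry.
  apply: le_trans (_ : _ <= f L)%E _.
    by move: lamL; rewrite -/A fA -EFinM.
  apply: f_mono => // x Lx j _; move: x Lx; apply: LP => //.
  by rewrite -/A fA -EFinM.
(* The midpoint of two distinct points of the ball is interior to it. *)
have A_sub x y : A x -> A y -> x = y.
  move=> [Kx xr] [Ky yr]; apply/subr0_eq/enorm_eq0/eqP; rewrite -sqrf_eq0.
  apply: contrapT => /negP xyN0; apply: nop.
  have xy0 : 0 < enorm (x - y) ^+ 2 by rewrite lt0r xyN0 sqr_ge0.
  have r0 : 0 <= r := le_trans (enorm_ge0 x) xr.
  exists ((1 - 2^-1) *: x + 2^-1 *: y); split.
    by apply: (convex_setP _).1 => //; lra.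
  rewrite enorm_lt_sqr // sqr_enorm_conv.
  move: xr yr; rewrite /eball/= !enorm_le_sqr //.
  by move: xy0; move: (enorm x ^+ 2) (enorm y ^+ 2) (enorm _ ^+ 2) (r ^+ 2) => a b c D;
    lra.
apply: (@le_trans _ _ (f A)).
  apply: le_trans (rP k w); rewrite lee_fin mulrBl mul1r gerBl.
  by rewrite mulr_ge0 // ltW.
apply: f_mono => //; first exact: convex_omit_eball.
move=> x Ax j _; have : e k j `&` A !=set0.
  apply/set0P/eqP => eA; have := meet j; rewrite eA f_set0 lee_fin leNgt.
  by rewrite mulr_gt0 // subr_gt0.
by move=> [y [ey Ay]]; rewrite (A_sub x y).
Qed.

End Closed.

(** Reduction to closed sets.  The hull [P i j] is contained in [e i j], and the
    points collected from the choice [w] lie in [P i (w i)] for every [i]; thus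
    the colourful intersections of the hulls are still large. *)
Lemma colorful_convex (e : 'I_h -> J -> set 'rV[R]_d) :
  (forall i j, convex_set (e i j)) ->
  (forall w : {ffun 'I_h -> J}, (lam%:E < f (\bigcap_i e i (w i)))%E) ->
  exists i, (((1 - delta) * lam)%:E <= f (\bigcap_j e i j))%E.
Proof.
move=> e_conv e_colorful.
have net (w : {ffun 'I_h -> J}) : exists s : seq 'rV[R]_d,
    (forall x, x \in s -> forall i, e i (w i) x) /\
    forall L, convex_set L -> (forall x, x \in s -> L x) -> (lam%:E < f L)%E.
  have cT : convex_set (\bigcap_i e i (w i)) by apply: convex_bigcap.
  have [r lamr] := truncation_gt f_cont cT (e_colorful w).
  have cTr := convex_setI cT (@convex_eball R d r).
  have [s sT sP] := finite_subset_gt f_cont cTr (@bounded_setI_eball _ _ _ r) lamr.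
  exists s; split=> [x /sT[ex _] i|L cL sL]; first exact: ex.
  apply: lt_le_trans (sP (L `&` (\bigcap_i e i (w i) `&` eball r)) _ _ _) _.
  - exact: convex_setI.
  - exact: subIsetr.
  - by move=> x xs; split; [exact: sL|exact: sT].
  - by apply: f_mono => //; exact: convex_setI.
have /choice[s sP] := net.
pose P i j := hull (flatten [seq s w |
  w : {ffun 'I_h -> J} <- enum [pred w : {ffun 'I_h -> J} | w i == j]]).
have P_sub i j : P i j `<=` e i j.
  apply: hull_sub => // x /flattenP[_ /mapP[w + ->]].
  by rewrite mem_enum inE => /eqP <- /(sP w).1.
have [||w|i iP] := @colorful_closed P.
- by move=> i j; exact: convex_hull.
- by move=> i j; exact: closed_hull.
- apply: (sP w).2; first by apply: convex_bigcap => i _; exact: convex_hull.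
  move=> x xs i _; apply: mem_hull; apply/flattenP; exists (s w) => //.
  by apply/mapP; exists w => //; rewrite mem_enum inE.
exists i; apply: le_trans iP _; apply: f_mono.
- by apply: convex_bigcap => j _; exact: convex_hull.
- exact: convex_bigcap.
- by move=> x Px j _; apply: P_sub; exact: Px.
Qed.

End Colorful.

Theorem theorem4p1 (R : realType) (d : nat) (f : set 'rV[R]_d -> \bar R)
    (H : R -> nat) (delta : R -> R)
    (f_ge0 : convex_nonneg f)
    (f_wd : well_defined f)
    (f_cont : hausdorff_continuous f)
    (f_mono : convex_monotone f)
    (f_helly : admits_helly f H)
    (f_float : has_floating_body f delta)
    (eps : R) (eps01 : 0 < eps < 1)
    (F : 'I_(H eps) -> set (set 'rV[R]_d))
    (F_fin : forall i, finite_set (F i))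
    (F_ne : forall i, F i !=set0)
    (F_conv : forall i A, F i A -> convex_set A)
    (F_colorful : forall c : 'I_(H eps) -> set 'rV[R]_d,
       (forall i, F i (c i)) -> (1 <= f (\bigcap_i c i))%E) :
  exists i, ((1 - delta eps)%:E <= f (\bigcap_(A in F i) A))%E.
Proof.
have [f_set0 _] := f_wd.
have helly := f_helly eps eps01.
have /andP[eps0 eps1] := eps01.
have [[delta0 float] _] := (f_float.1 eps eps01, tt).
have [i0] : inhabited 'I_(H eps).
  (* A Helly number 0 would bound [f set0] from below. *)
  case: (H eps) helly F F_colorful {F_fin F_ne F_conv} => [|h] helly F F_colorful; last first.
    by constructor; exact: ord0.
  exfalso; have := helly [set set0] 1.
  rewrite bigcap_set1 f_set0 mulr1 lee_fin => /(_ (finite_set1 _)).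
  suff : ~ (1 - eps <= 0).
    move=> n /(_ _ ltr01) H1; apply: n; apply: H1 => [_ ->|G _].
      exact: convex_set0.
    rewrite II0 card_le0 => /eqP ->; rewrite bigcap_set0.
    apply: le_trans (F_colorful (fun=> set0) _) _; first by case.
    by apply: f_mono.
  by apply/negP; rewrite -ltNge subr_gt0.
have cF i : convex_set (\bigcap_(A in F i) A).
  by apply: convex_bigcap => A; exact: F_conv.
apply: contrapT => nF.
have {}nF i : (f (\bigcap_(A in F i) A) < (1 - delta eps)%:E)%E.
  by rewrite ltNge; apply/negP => ?; apply: nF; exists i.
have delta1 : 0 < 1 - delta eps.
  by rewrite -lte_fin; apply: le_lt_trans (nF i0); exact: f_ge0.
have [|i lam lam' ll' [lam0 lamP]|i|lam lam1 lamP] := @finite_common_bound R 'I_(H eps)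
    [set lam | lam < 1]
    (fun i lam => 0 < lam /\ (f (\bigcap_(A in F i) A) < ((1 - delta eps) * lam)%:E)%E).
- by exists 0 => /=.
- split; first exact: lt_le_trans ll'.
  by apply: lt_le_trans lamP _; rewrite lee_fin ler_pM2l.
- have := f_ge0 _ (cF i); move: (nF i).
  case: (f _) => [v| |] //; rewrite lte_fin lee_fin => v1 v0.
  (* The midpoint between 1 and the critical value of [lam]. *)
  exists ((v / (1 - delta eps) + 1) / 2).
    rewrite /= ltr_pdivrMr // mul1r -[ltRHS]/(1 + 1) ltrD2r.
    by rewrite ltr_pdivrMr // mul1r.
  split; first by rewrite divr_gt0 // ltr_wpDl // divr_ge0 // ltW.
  rewrite lte_fin [ltRHS](_ : _ = (v + (1 - delta eps)) / 2); last by field; exact: lt0r_neq0.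
  by lra.
have lam0 := (lamP i0).1.
(* All classes are indexed by one finite type: the indices of an enumeration
   [s] of their union.  An index whose set is not in [F i] stands for a fixed
   member of [F i]; the index past the end of [s] makes the type nonempty. *)
have /finite_seqP[s sE] : finite_set (\bigcup_i F i).
  by apply: bigcup_finite => //; exact: finite_finset.
have /choice[a aF] : forall i, exists A, F i A by move=> i; have [A FA] := F_ne i; exists A.
pose e i (j : 'I_(size s).+1) := if nth set0 s j \in F i then nth set0 s j else a i.
have eF i j : F i (e i j).
  by rewrite /e; case: ifPn => [|_]; [rewrite inE|exact: aF].
have [||i iP] := @colorful_convex R d f f_set0 f_cont f_mono eps (delta eps) _ helly eps1
  delta0 float 'I_(size s).+1 i0 ord0 lam lam0 e.
- by move=> i j; exact: F_conv (eF i j).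
- move=> w; apply: lt_le_trans (F_colorful (fun i => e i (w i)) _) => //.
have := (lamP i).2; rewrite ltNge => /negP; apply.
apply: le_trans iP _; apply: f_mono => //.
  by apply: convex_bigcap => j _; exact: F_conv (eF i j).
move=> x ex A FA.
have As : A \in s by have : [set` s] A by rewrite -sE; exists i.
have jlt : (index A s < (size s).+1)%N by rewrite ltnS index_size.
have := ex (Ordinal jlt) I; rewrite /e /= nth_index //.
by rewrite mem_set.
Qed.
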